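(* Every Gorenstein sequence $H=(1,4,7,\dots)$ of socle degree $j$ for $R=K[w,x,y,z]$ satisfies: $\Delta H_{\le j/2}$ is an $O$-sequence.
   Context: $K$ algebraically closed, $R$ standard graded; a Gorenstein sequence of socle degree $j$ is the Hilbert function $(h_0,\dots,h_j)$, $h_j\ne0$, of a standard graded Artinian Gorenstein quotient of $R$. $\Delta H_i=h_i-h_{i-1}$ ($h_{-1}=0$) and $\Delta H_{\le j/2}=(\Delta H_i)_{0\le i\le j/2}$. For $c,d>0$ write $c=\sum_{i=1}^d\binom{k(i)}{i}$ with $k(d)>\dots>k(1)\ge0$ and $c^{(d)}=\sum_{i=1}^d\binom{k(i)+1}{i+1}$, $0^{(d)}=0$; an $O$-sequence is $(1,t_1,t_2,\dots)$ with $t_i\ge0$ and $t_{d+1}\le t_d^{(d)}$ for all $d\ge1$. *)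

(* Defs.v *)
From HB Require Import structures.
From mathcomp Require Import all_boot all_order all_algebra.
From mathcomp Require Import mpoly.
Set Implicit Arguments. Unset Strict Implicit. Unset Printing Implicit Defensive.
Import Order.TTheory GRing.Theory Num.Theory.
Local Open Scope ring_scope.

Section Gor.
Variable K : closedFieldType.
Local Notation R := {mpoly K[4]}.

Definition is_ideal (I : R -> Prop) : Prop :=
  I 0 /\ (forall p q, I p -> I q -> I (p + q)) /\ (forall r p, I p -> I (r * p)).

Definition is_homogeneous_ideal (I : R -> Prop) : Prop :=
  is_ideal I /\ forall p d, I p -> I (@pihomog 4 K mdeg d p).

(* there are n elements of degree i in A = R/I which are K-linearly
   independent in A_i = R_i / I_i *)
Definition indep_deg (I : R -> Prop) (i n : nat) : Prop :=
  exists f : 'I_n -> R, (forall k, f k \is i.-homog) /\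
    forall c : 'I_n -> K, I (\sum_(k < n) c k *: f k) -> forall k, c k = 0.

Definition hilb (I : R -> Prop) (i h : nat) : Prop :=
  indep_deg I i h /\ forall n, indep_deg I i n -> (n <= h)%N.

(* the socle (0 :_A m) of A = R/I, m = (w,x,y,z), is a one-dimensional
   K-subspace of A *)
Definition in_socle (I : R -> Prop) (p : R) : Prop :=
  forall k : 'I_4, I ('X_k * p).

Definition gorenstein_socle (I : R -> Prop) : Prop :=
  exists p, in_socle I p /\ ~ I p /\
    forall q, in_socle I q -> exists c : K, I (q - c *: p).

(* H = (h_0, ..., h_j) is a Gorenstein sequence of socle degree j:
   Hilbert function of a standard graded Artinian Gorenstein quotient R/I,
   with h_j <> 0 and h_i = 0 for i > j (Artinian). *)
Definition gorenstein_sequence (H : seq nat) (j : nat) : Prop :=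
  size H = j.+1 /\ nth 0%N H j <> 0%N /\
  exists I : R -> Prop, is_homogeneous_ideal I /\ gorenstein_socle I /\
    forall i, hilb I i (nth 0%N H i).
End Gor.

Definition deltaH (H : seq nat) (i : nat) : int :=
  (nth 0%N H i)%:Z - (if i is i'.+1 then (nth 0%N H i')%:Z else 0).

Definition deltaH_half (H : seq nat) (j : nat) : seq int :=
  [seq deltaH H i | i <- iota 0 (j./2).+1].

(* macaulay_upper c d u : u = c^(d) (for d > 0), via the d-binomial
   expansion c = sum_{i=1}^d C(k(i), i), k(d) > ... > k(1) >= 0 *)
Definition macaulay_upper (c d u : nat) : Prop :=
  (c = 0%N /\ u = 0%N) \/
  ((0 < c)%N /\ exists k : nat -> nat,
      (forall i, (0 < i)%N -> (i < d)%N -> (k i < k i.+1)%N) /\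
      c = (\sum_(1 <= i < d.+1) 'C(k i, i))%N /\
      u = (\sum_(1 <= i < d.+1) 'C((k i).+1, i.+1))%N).

Definition O_sequence (t : seq int) : Prop :=
  nth 0 t 0 = 1 /\ (forall i, (i < size t)%N -> 0 <= nth 0 t i) /\
  forall d, (0 < d)%N -> (d.+1 < size t)%N ->
    exists u, macaulay_upper (absz (nth 0 t d)) d u /\ nth 0 t d.+1 <= u%:Z.

(* Main.v *)
(* Write t for the first difference of H. Gorenstein duality makes the rank of
   multiplication by a linear form L symmetric, whence, with c the Hilbert function
   of A/LA, t_i = c_i - c_(j+1-i). If moreover A/(L,l)A vanishes in degree m for some
   linear l, then c is nonincreasing from degree m - 1 on, and so t is nonnegative
   and nonincreasing between m - 1 and j/2.

   If the three quadrics of I have no common factor, they have no common zero on some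
   line L = l = 0, and m = 3 is possible: otherwise, fixing a point P off the quadric
   q1, the resultant of the restrictions of q1 and q2 to the lines through P vanishes
   identically, for all q2 in I_2 through P, and this forces a common linear factor.

   If I_2 = w V, then I : w has colength one in each degree below j, so
   t_i = i + 1 as long as I_i stays inside (w). In the least degree m where it does
   not, a line cutting the plane w = 0 in a general point makes A/(L,l)A vanish in
   degree m, and the first argument takes over. *)
Require Import Defs.
From HB Require Import structures.
From mathcomp Require Import all_boot all_order all_algebra.
From mathcomp Require Import mpoly.
From mathcomp Require Import ring zify.
From Stdlib Require Import Classical ClassicalEpsilon.
Set Implicit Arguments. Unset Strict Implicit. Unset Printing Implicit Defensive.
Import GRing.Theory.
Local Open Scope ring_scope.

(** * Polynomials and linear forms *)

Section Polynomials.
Variables (n : nat) (K : closedFieldType).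
Local Notation R := {mpoly K[n]}.
Implicit Types (p q : R) (v : 'I_n -> K).

Lemma mpoly_ring_ind (P : R -> Prop) :
  (forall c, P c%:MP) -> (forall k, P 'X_k) ->
  (forall p q, P p -> P q -> P (p + q)) -> (forall p q, P p -> P q -> P (p * q)) ->
  forall p, P p.
Proof.
move=> PC PX PD PM p; rewrite [p]mpolyE; elim/big_ind: _ => [|//|m _].
  by rewrite -mpolyC0.
rewrite -mul_mpolyC; apply: (PM) => //; rewrite mpolyXE_id.
elim/big_ind: _ => [|//|k _]; first by rewrite -mpolyC1.
elim: (m k) => [|d IHd]; first by rewrite expr0 -mpolyC1.
by rewrite exprS; apply: PM.
Qed.

(** Every monomial of positive degree has a variable to factor out. This stands in for Euler's
    formula, which would require dividing by the degree. *)
Lemma homog_succ d p : p \is d.+1.-homog ->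
  exists g : 'I_n -> R, (forall k, g k \is d.-homog) /\ p = \sum_k 'X_k * g k.
Proof.
move=> hp; rewrite [p]mpolyE big_seq.
elim/big_ind: _ => [|x y [g [hg ->]] [g' [hg' ->]]|m mp].
- exists (fun=> 0); split=> [k|]; first exact: rpred0.
  by rewrite big1 // => k _; rewrite mulr0.
- exists (fun k => g k + g' k); split=> [k|]; first exact: rpredD.
  by rewrite -big_split; apply: eq_bigr => k _; rewrite mulrDr.
have dm : mdeg m = d.+1 by move/dhomogP: hp => /(_ _ mp).
have [k mk] : exists k, (0 < m k)%N.
  apply/existsP/contraT; rewrite negb_exists => /forallP m0.
  move: dm; rewrite mdegE big1 // => k _; apply/eqP.
  by rewrite -leqn0 leqNgt.
have le1m : (U_(k) <= m)%MM.
  by apply/mnm_lepP => i; rewrite mnm1E; case: eqP => // <-.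
exists (fun i => if i == k then p@_m *: 'X_[(m - U_(k))%MM] else 0); split.
  move=> i; case: ifP => _; last exact: rpred0.
  apply: rpredZ; rewrite dhomogX -(eqn_add2r (mdeg U_(k)%MM)) -mdegD.
  by rewrite submK // mdeg1 dm addn1.
rewrite (bigD1 k) //= eqxx big1 ?addr0 => [|i /negPf ->]; last by rewrite mulr0.
by rewrite -scalerAr -mpolyXD addmC submK //.
Qed.

Lemma homog0 p : p \is 0.-homog -> exists c, p = c%:MP.
Proof.
move=> hp; exists p@_0; apply/mpolyP => m; rewrite mcoeffC.
have [->|nm] := eqVneq m 0%MM; first by rewrite mulr1.
by rewrite mulr0 (dhomog_nemf_coeff hp) // mdeg_eq0.
Qed.

Lemma pihomogM e G d p : G \is e.-homog ->
  pihomog mdeg (e + d) (G * p) = G * pihomog mdeg d p.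
Proof.
(* The bound also exceeds [d], so that the component of degree [d] occurs in the sum even if [p] has
   lower degree. *)
move=> hG; pose k := (maxn (msize p) d.+1).
have E : p = \sum_(i < k) pihomog mdeg i p.
  by apply: pihomog_partitionE; apply: leq_maxl.
rewrite {1}E mulr_sumr linear_sum /=.
have dk : (d < k)%N by rewrite leq_max ltnSn orbT.
rewrite (bigD1 (Ordinal dk)) //= big1 ?addr0 => [|i ne].
  by apply: pihomog_dE; apply: dhomogM => //; apply: pihomogP.
apply: (@pihomog_ne0 _ _ _ (e + i)).
  by rewrite eqn_add2l; apply: contraNneq ne => /esym ?; apply/eqP/val_inj.
by apply: dhomogM => //; apply: pihomogP.
Qed.

Lemma pihomogM1 L d p : L \is 1.-homog ->
  pihomog mdeg d.+1 (L * p) = L * pihomog mdeg d p.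
Proof. exact: pihomogM. Qed.

Lemma homogM1 L d p : L \is 1.-homog -> p \is d.-homog -> L * p \is d.+1.-homog.
Proof. exact: (@dhomogM _ _ mdeg 1). Qed.

Lemma pihomogM_lt e G d p : G \is e.-homog -> (d < e)%N ->
  pihomog mdeg d (G * p) = 0.
Proof.
move=> hG de; rewrite [p](@pihomog_partitionE _ _ mdeg (msize p)) //.
rewrite mulr_sumr linear_sum /= big1 // => i _.
apply: (@pihomog_ne0 _ _ _ (e + i)); last by apply: dhomogM => //; apply: pihomogP.
by rewrite gtn_eqF // ltn_addr.
Qed.

(** Uniqueness of digits in base [N]: it keeps the exponents of a Kronecker substitution
    distinct. *)
Lemma digits_inj (N d : nat) (a b : 'I_d -> nat) :
  (forall i, a i < N)%N -> (forall i, b i < N)%N ->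
  (\sum_i a i * N ^ i = \sum_i b i * N ^ i)%N -> a =1 b.
Proof.
elim: d a b => [|d IHd] a b aN bN; first by move=> _ [].
have split_digit c : (forall i : 'I_d.+1, c i < N)%N -> (\sum_i c i * N ^ i =
    (\sum_(i < d) c (lift ord0 i) * N ^ i) * N + c ord0)%N.
  move=> _; rewrite big_ord_recl expn0 muln1 addnC big_distrl; congr addn.
  by apply: eq_bigr => i _; rewrite /= -mulnA -expnSr.
rewrite !split_digit // => E.
have N0 : (0 < N)%N by apply: leq_trans (aN ord0).
have E0 : a ord0 = b ord0.
  by have := congr1 (modn^~ N) E; rewrite !modnMDl !modn_small.
move: E; rewrite E0 => /addIn /eqP; rewrite eqn_pmul2r // => /eqP E i.
case: (unliftP ord0 i) => [k|] -> //.
by apply: (IHd (a \o lift ord0) (b \o lift ord0)) => [l|l|]; rewrite ?E //=.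
Qed.

(* Kronecker substitution X_i := t ^ (N ^ i). *)
Lemma meval_eq0 p : (forall v, p.@[v] = 0) -> p = 0.
Proof.
move=> p0; pose N := msize p; pose e (m : 'X_{1..n}) := (\sum_i m i * N ^ i)%N.
pose P : {poly K} := \sum_(m <- msupp p) p@_m *: 'X^(e m).
have P0 : P = 0.
  (* A nonzero univariate polynomial has a nonroot over an algebraically closed field, but each
     value of [P] is a value of [p]. *)
  apply/eqP/negPn/negP => /closed_nonrootP [t /negP]; apply; apply/rootP.
  rewrite -(p0 (fun i => t ^+ (N ^ i))) mevalE horner_sum; apply: eq_bigr => m _.
  rewrite hornerZ hornerXn expr_sum; congr (_ * _); apply: eq_bigr => i _.
  by rewrite mulnC exprM.
apply/mpolyP => m0; rewrite mcoeff0; apply/eqP; rewrite mcoeff_eq0; apply/negP => m0p.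
have /eqP := congr1 (fun Q : {poly K} => Q`_(e m0)) P0.
rewrite coef0 coef_sum (bigD1_seq m0) ?msupp_uniq //= coefZ coefXn eqxx mulr1.
rewrite big_seq_cond big1 ?addr0 => [|m /andP [mp /negPf mm0]].
  by rewrite mcoeff_eq0 m0p.
rewrite coefZ coefXn; case: eqP => [/digits_inj E|_]; last by rewrite mulr0.
suff /mnmP E' : m0 =1 m by rewrite E' eqxx in mm0.
have ltN m' : m' \in msupp p -> forall i, (m' i < N)%N.
  by move=> /msize_mdeg_lt lt i; apply: leq_ltn_trans lt; rewrite mdegE (bigD1 i) ?leq_addr.
by apply: E; apply: ltN.
Qed.

Lemma homog1 p : p \is 1.-homog -> exists a : 'I_n -> K, p = \sum_k a k *: 'X_k.
Proof.
move=> /homog_succ [g [hg ->]]; have /fin_all_exists [a ga] k := homog0 (hg k).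
by exists a; apply: eq_bigr => k _; rewrite ga mulrC mul_mpolyC.
Qed.

Lemma homogX k : ('X_k : R) \is 1.-homog.
Proof. by rewrite dhomogX; apply/eqP; apply: mdeg1. Qed.

Lemma meval_homog d p v c : p \is d.-homog ->
  p.@[fun k => c * v k] = c ^+ d * p.@[v].
Proof.
elim: d p => [|d IHd] p; first by move=> /homog0 [b ->]; rewrite !mevalC mul1r.
move=> /homog_succ [g [hg ->]]; rewrite !raddf_sum mulr_sumr /=; apply: eq_bigr => k _.
by rewrite !mevalM !mevalXU IHd // exprS; ring.
Qed.

(* The substitution X_k := X_k - w / w_k kills w and is the identity modulo w. *)
Lemma hyperplane_subst w : w \is 1.-homog -> w != 0 ->
  exists s : n.-tuple R,
  (forall p, exists g, p = w * g + (p \mPo s)) /\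
  (forall v, w.@[fun k => (tnth s k).@[v]] = 0) .
Proof.
move=> /homog1 [a Ew] w0.
have [k0 ak0] : exists k, a k != 0.
  apply/existsP/contraT; rewrite negb_exists => /forallP a0.
  move/eqP: w0; case; rewrite Ew big1 // => k _.
  by move/negPn/eqP: (a0 k) => ->; rewrite scale0r.
pose s := [tuple if k == k0 then 'X_k - (a k0)^-1 *: w else 'X_k | k < n].
exists s; split=> [|v].
  apply: mpoly_ring_ind => [c|k|p q [g Ep] [g' Eq]|p q [g Ep] [g' Eq]].
  - by exists 0; rewrite comp_mpolyC mulr0 add0r.
  - exists (if k == k0 then (a k0)^-1%:MP else 0).
    rewrite comp_mpolyXU -tnth_nth tnth_mktuple; case: eqP => _.
      by rewrite mulrC mul_mpolyC addrC subrK.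
    by rewrite mulr0 add0r.
  - by exists (g + g'); rewrite {1}Ep {1}Eq rmorphD /=; ring.
  - exists (g * q + (p \mPo s) * g'); rewrite rmorphM /= {1}Ep mulrDl.
    by rewrite {2}Eq; ring.
rewrite {1}Ew raddf_sum /= (bigD1 k0) //= mevalZ mevalXU tnth_mktuple eqxx.
rewrite mevalB mevalZ mevalXU (eq_bigr (fun k => a k * v k)) => [|k /negPf kk0].
  have Ewv : w.@[v] = a k0 * v k0 + \sum_(i | i != k0) a i * v i.
    rewrite Ew raddf_sum /= (bigD1 k0) //= mevalZ mevalXU; congr (_ + _).
    by apply: eq_bigr => k _; rewrite mevalZ mevalXU.
  by rewrite Ewv mulrBr mulrA mulfV //; ring.
by rewrite mevalZ mevalXU tnth_mktuple kk0 mevalXU.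
Qed.

(** The substitution moves every point into the hyperplane [w = 0], so the remainder [p \mPo s]
    vanishes everywhere. *)
Lemma linear_form_dvd w p : w \is 1.-homog -> w != 0 ->
  (forall v, w.@[v] = 0 -> p.@[v] = 0) -> exists g, p = w * g.
Proof.
move=> hw w0 p0; have [s [sP s0]] := hyperplane_subst hw w0.
have [g ->] := sP p; exists g; rewrite [p \mPo s]meval_eq0 ?addr0 // => v.
by rewrite comp_mpoly_meval p0.
Qed.

(** The remainders of [p] and [q] modulo [w] are nonzero, hence so is their product, which then has
    a nonzero value. *)
Lemma linear_form_ndvd2 w p q : w \is 1.-homog -> w != 0 ->
  ~ (exists g, p = w * g) -> ~ (exists g, q = w * g) ->
  exists v, [/\ w.@[v] = 0, p.@[v] != 0 & q.@[v] != 0].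
Proof.
move=> hw w0 np nq; have [s [sP s0]] := hyperplane_subst hw w0.
have nz r : ~ (exists g, r = w * g) -> r \mPo s != 0.
  by move=> nr; apply/eqP => E; apply: nr; have [g] := sP r; rewrite E addr0; exists g.
have : (p \mPo s) * (q \mPo s) != 0 by rewrite mulf_neq0 ?nz.
move=> /eqP pq0; apply: NNPP => nv; apply: pq0; apply: meval_eq0 => v.
rewrite mevalM !comp_mpoly_meval; apply/eqP/negPn; rewrite mulf_eq0 negb_or.
by apply/negP => /andP [pv qv]; apply: nv; exists (fun k => (tnth s k).@[v]).
Qed.

Lemma homog_dvd e d w p g : w \is e.-homog -> p \is (e + d).-homog -> p = w * g ->
  exists2 g', g' \is d.-homog & p = w * g'.
Proof.
move=> hw hp E; exists (pihomog mdeg d g); first exact: pihomogP.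
by rewrite -(pihomogM _ _ hw) -E pihomog_dE.
Qed.

End Polynomials.

(** * Hilbert functions of ideals *)

Section Ideals.
Variable K : closedFieldType.
Local Notation R := {mpoly K[4]}.
Implicit Types (J : R -> Prop) (p q G L : R).

Lemma ideal0 J : is_ideal J -> J 0. Proof. by case. Qed.
Lemma idealD J p q : is_ideal J -> J p -> J q -> J (p + q).
Proof. by case=> _ [D _]; apply: D. Qed.
Lemma idealM J r p : is_ideal J -> J p -> J (r * p).
Proof. by case=> _ [_ M]; apply: M. Qed.
Lemma ideal_mulr J r p : is_ideal J -> J p -> J (p * r).
Proof. by move=> hJ Jp; rewrite mulrC; apply: idealM. Qed.
Lemma idealZ J c p : is_ideal J -> J p -> J (c *: p).
Proof. by rewrite -mul_mpolyC; apply: idealM. Qed.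
Lemma idealN J p : is_ideal J -> J p -> J (- p).
Proof. by rewrite -scaleN1r; apply: idealZ. Qed.
Lemma idealB J p q : is_ideal J -> J p -> J q -> J (p - q).
Proof. by move=> hJ Jp Jq; apply: idealD => //; apply: idealN. Qed.
Lemma ideal_sum J (I : Type) (r : seq I) (P : pred I) (F : I -> R) :
  is_ideal J -> (forall i, P i -> J (F i)) -> J (\sum_(i <- r | P i) F i).
Proof.
move=> hJ hF; elim/big_ind: _ => //; first exact: ideal0.
by move=> x y; apply: idealD.
Qed.
Lemma idealBC J p q : is_ideal J -> J (p - q) -> J q -> J p.
Proof. by move=> hJ h1 h2; rewrite -(subrK q p); apply: idealD. Qed.

(** * Independent and generating families modulo an ideal *)

Definition free_mod J m (f : 'I_m -> R) :=
  forall c : 'I_m -> K, J (\sum_(k < m) c k *: f k) -> forall k, c k = 0.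

Definition gen_mod J i m (f : 'I_m -> R) :=
  forall p, p \is i.-homog -> exists c : 'I_m -> K, J (p - \sum_(k < m) c k *: f k).

Lemma row_kernel (m r : nat) (A : 'M[K]_(m, r)) : (r < m)%N ->
  exists2 x : 'rV[K]_m, x != 0 & x *m A = 0.
Proof.
move=> rm; have : kermx A != 0.
  rewrite -mxrank_eq0 mxrank_ker subn_eq0 -ltnNge.
  by apply: leq_ltn_trans rm; apply: rank_leq_col.
by move=> /rowV0Pn [x /sub_kermxP xA x0]; exists x.
Qed.

(** If [r < m], the matrix expressing [f] through [g] has a nonzero left kernel vector, which is a
    forbidden relation among the [f k]. *)
Lemma steinitz J m r (f : 'I_m -> R) (g : 'I_r -> R) : is_ideal J -> free_mod J f ->
  (forall k, exists c : 'I_r -> K, J (f k - \sum_l c l *: g l)) -> (m <= r)%N.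
Proof.
move=> hJ ff /fin_all_exists [c hc]; rewrite leqNgt; apply/negP => rm.
have [x x0 xA] := row_kernel (\matrix_(k, l) c k l) rm.
case/negP: x0; apply/eqP/rowP => k; rewrite mxE; apply: (ff (fun k => x 0 k)).
have -> : \sum_k x 0 k *: f k = \sum_k x 0 k *: (f k - \sum_l c k l *: g l).
  rewrite -[LHS]subr0; under [RHS]eq_bigr do rewrite scalerBr.
  rewrite sumrB; congr (_ - _); under eq_bigr do rewrite scaler_sumr.
  rewrite exchange_big /= big1 // => l _.
  under eq_bigr do rewrite scalerA; rewrite -scaler_suml.
  move/rowP: xA => /(_ l); rewrite !mxE => E.
  by rewrite -[X in X *: _](_ : 0 = _) ?scale0r // -[LHS]E; apply: eq_bigr => i _; rewrite mxE.
by apply: ideal_sum => // i _; apply: idealZ.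
Qed.

Lemma free_extend J m (f : 'I_m -> R) p : is_ideal J -> free_mod J f ->
  ~ (exists c : 'I_m -> K, J (p - \sum_(k < m) c k *: f k)) ->
  free_mod J (fun k : 'I_m.+1 => if unlift ord_max k is Some k' then f k' else p).
Proof.
move=> hJ ff np c.
pose d k := c (lift ord_max k).
have -> : \sum_(k < m.+1) c k *: (if unlift ord_max k is Some k' then f k' else p)
   = \sum_k d k *: f k + c ord_max *: p.
  rewrite big_ord_recr /= unlift_none; congr (_ + _); apply: eq_bigr => k _.
  have -> : widen_ord (leqnSn m) k = lift ord_max k by apply: val_inj; rewrite [RHS]lift_max.
  by rewrite liftK.
move=> Jc; have cm : c ord_max = 0.
  apply/eqP/contraT => cm; exfalso; apply: np.
  exists (fun k => - (c ord_max)^-1 * d k).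
  have := idealZ (c ord_max)^-1 hJ Jc; rewrite scalerDr scalerA mulVf // scale1r.
  rewrite scaler_sumr addrC -sumrN; congr (J (_ + _)); apply: eq_bigr => k _.
  by rewrite scalerA mulNr scaleNr opprK.
move: Jc; rewrite cm scale0r addr0 => /ff d0 k.
by case: (unliftP ord_max k) => [k'|] ->; [apply: d0 | apply: cm].
Qed.

(** An independent family of maximal size generates, since a form outside its span could be added;
    conversely, Steinitz bounds independent families by a generating one. *)
Lemma hilbP J i h : is_ideal J -> hilb J i h <->
  exists f : 'I_h -> R, [/\ forall k, f k \is i.-homog, free_mod J f & gen_mod J i f].
Proof.
move=> hJ; split=> [[[f [hf ff]] hmax]|[f [hf ff gf]]].
  exists f; split=> // p hp; apply: NNPP => np.
  suff /hmax : indep_deg J i h.+1 by rewrite ltnn.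
  exists (fun k : 'I_h.+1 => if unlift ord_max k is Some k' then f k' else p).
  by split; [move=> k; case: (unlift _ _) | apply: free_extend].
split; first by exists f.
by move=> m [g [hg fg]]; apply: (steinitz hJ fg (g := f)) => k; apply: gf.
Qed.

Lemma hilb_uniq J i h h' : hilb J i h -> hilb J i h' -> h = h'.
Proof.
move=> [ih hm] [ih' hm']; apply/eqP; rewrite eqn_leq.
by rewrite (hm _ ih') (hm' _ ih).
Qed.

(** * The Hilbert function of the polynomial ring, and existence in general *)

Definition zero_ideal : R -> Prop := fun p => p = 0.

Lemma zero_idealP : is_homogeneous_ideal zero_ideal.
Proof.
split=> [|p d ->]; last by rewrite /zero_ideal pihomog0.
split=> //; split=> [p q -> ->|r p ->]; first by rewrite /zero_ideal addr0.
by rewrite /zero_ideal mulr0.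
Qed.

Lemma hilb_zero i : hilb zero_ideal i 'C(i + 3, i).
Proof.
apply/hilbP; first by case: zero_idealP.
(* The exponents of the monomials of degree [i], read off from the sorted tuples of their
   variables. *)
pose b := [seq s2m t | t : i.-tuple 'I_4 <- enum (basis 4 i)].
have sb : size b = 'C(i + 3, i) by apply: size_basis.
have ub : uniq b by apply: uniq_basis.
have bP m : (mdeg m == i) = (m \in b) by apply: basis_cover.
pose e (k : 'I_('C(i + 3, i))) := nth 0%MM b k.
have co (c : 'I_('C(i + 3, i)) -> K) l : (\sum_k c k *: 'X_[e k])@_(e l) = c l.
  rewrite raddf_sum (bigD1 l) //= mcoeffZ mcoeffX eqxx mulr1 big1 ?addr0 // => k kl.
  by rewrite mcoeffZ mcoeffX nth_uniq ?sb // (inj_eq val_inj) (negPf kl) mulr0.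
exists (fun k => 'X_[e k]); split=> [k|c c0 k|p hp].
- by rewrite dhomogX bP mem_nth // sb.
- by rewrite -(co c k) c0 mcoeff0.
exists (fun k => p@_(e k)); apply/eqP; rewrite subr_eq0; apply/eqP/mpolyP => m.
have [mb|mb] := boolP (m \in b); last first.
  rewrite (dhomog_nemf_coeff hp); last by rewrite bP.
  rewrite raddf_sum big1 // => k _; rewrite /= mcoeffZ mcoeffX.
  by case: eqP => [E|_]; rewrite ?mulr0 //; rewrite -E mem_nth ?sb in mb.
have mi : (index m b < 'C(i + 3, i))%N by rewrite -sb index_mem.
by have := co (fun k => p@_(e k)) (Ordinal mi); rewrite /e /= nth_index.
Qed.

Lemma hilb_ex J i : is_ideal J -> exists h, hilb J i h.
Proof.
move=> hJ; have bd m : indep_deg J i m -> (m <= 'C(i + 3, i))%N.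
  move=> [f [hf ff]]; have [_] := hilb_zero i; apply; exists f; split=> // c c0.
  by apply: ff; rewrite c0; apply: ideal0.
have ex0 : exists m, indep_deg J i m.
  by exists 0%N; exists (fun=> 0); split=> [|c _] [].
pose P m := if excluded_middle_informative (indep_deg J i m) then true else false.
have PP m : reflect (indep_deg J i m) (P m).
  by rewrite /P; case: excluded_middle_informative => h; constructor.
have exP : exists m, P m by have [m /PP] := ex0; exists m.
have bdP m : P m -> (m <= 'C(i + 3, i))%N by move=> /PP /bd.
case: (ex_maxnP exP bdP) => h /PP hh hmax.
by exists h; split=> // m /PP /hmax.
Qed.

(** Choice turns the relation [hilb] into a total function, so that its values can be computed with;
    [hilbertP] gives them their meaning. *)
Definition hilbert J i : nat := epsilon (inhabits 0%N) (hilb J i).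

Lemma hilbertP J i : is_ideal J -> hilb J i (hilbert J i).
Proof. by move=> hJ; apply: epsilon_spec; apply: hilb_ex. Qed.

Lemma hilbert_eq J i h : hilb J i h -> hilbert J i = h.
Proof.
by move=> hh; apply: (hilb_uniq _ hh); apply: epsilon_spec; exists h.
Qed.

Lemma hilbert_zero i : hilbert zero_ideal i = 'C(i + 3, i).
Proof. exact/hilbert_eq/hilb_zero. Qed.

Lemma hilbert_basis J i : is_ideal J -> exists f : 'I_(hilbert J i) -> R,
  [/\ forall k, f k \is i.-homog, free_mod J f & gen_mod J i f].
Proof. by move=> hJ; apply/hilbP => //; apply: hilbertP. Qed.

Lemma hilbert_le J i r (g : 'I_r -> R) : is_ideal J -> gen_mod J i g -> (hilbert J i <= r)%N.
Proof.
move=> hJ gg; have [f [hf ff _]] := hilbert_basis i hJ.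
by apply: (steinitz hJ ff (g := g)) => k; apply: gg.
Qed.

Lemma hilbert_ext J J' i : is_ideal J -> is_ideal J' ->
  (forall p, p \is i.-homog -> J p <-> J' p) -> hilbert J i = hilbert J' i.
Proof.
move=> hJ hJ' E; apply/esym/hilbert_eq/hilbP => //.
have [f [hf ff gf]] := hilbert_basis i hJ; exists f.
have hc c : \sum_k c k *: f k \is i.-homog by apply: rpred_sum => k _; apply: rpredZ.
split=> // [c|p hp]; first by move/(E _ (hc _)); apply: ff.
have [c Jc] := gf p hp; exists c.
have [] := E (p - \sum_k c k *: f k); last by move=> h _; apply: h.
by apply: rpredB; [|apply: hc].
Qed.

Lemma hilbert_eq0 J i : is_ideal J -> (forall p, p \is i.-homog -> J p) <-> hilbert J i = 0%N.
Proof.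
move=> hJ; split=> [h|h p hp].
  apply/eqP; rewrite -leqn0; apply: (@hilbert_le _ _ _ (fun=> 0)) => // p /h Jp.
  by exists (fun=> 0); rewrite big_ord0 subr0.
have := hilbert_basis i hJ; rewrite h => -[f [_ _ /(_ p hp) [c]]].
by rewrite big_ord0 subr0.
Qed.

(** * The ideal quotient [J : G] and the sum [J + (L)] *)

Definition colon J G : R -> Prop := fun p => J (G * p).
Definition adjoin J L : R -> Prop := fun p => exists a, J (p - L * a).

Lemma colon_ideal J G : is_ideal J -> is_ideal (colon J G).
Proof.
move=> hJ; split; first by rewrite /colon mulr0; apply: ideal0.
split=> [p q|r p]; first by rewrite /colon mulrDr; apply: idealD.
by rewrite /colon mulrCA; apply: idealM.
Qed.

Lemma adjoin_ideal J L : is_ideal J -> is_ideal (adjoin J L).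
Proof.
move=> hJ; split; first by exists 0; rewrite mulr0 subr0; apply: ideal0.
split=> [p q [a Ja] [b Jb]|r p [a Ja]].
  by exists (a + b); rewrite mulrDr opprD addrACA; apply: idealD.
by exists (r * a); rewrite mulrCA -mulrBr; apply: idealM.
Qed.

Lemma adjoin_sub J L p : is_ideal J -> J p -> adjoin J L p.
Proof. by move=> hJ Jp; exists 0; rewrite mulr0 subr0. Qed.

Lemma adjoin_gen J L a : is_ideal J -> adjoin J L (L * a).
Proof. by move=> hJ; exists a; rewrite subrr; apply: ideal0. Qed.

Lemma adjoin_homog J L : is_homogeneous_ideal J -> L \is 1.-homog ->
  is_homogeneous_ideal (adjoin J L).
Proof.
move=> [hJ gJ] hL; split; first exact: adjoin_ideal.
move=> p [|d] [a Ja].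
  by apply: adjoin_sub => //; have := gJ _ 0%N Ja; rewrite pihomogB (pihomogM_lt _ hL) // subr0.
exists (pihomog mdeg d a); have := gJ _ d.+1 Ja.
by rewrite pihomogB pihomogM1 //.
Qed.

Lemma adjoin_homogP J L i p : is_homogeneous_ideal J -> L \is 1.-homog ->
  p \is i.+1.-homog -> adjoin J L p -> exists2 a, a \is i.-homog & J (p - L * a).
Proof.
move=> [hJ gJ] hL hp [a Ja]; exists (pihomog mdeg i a); first exact: pihomogP.
by have := gJ _ i.+1 Ja; rewrite pihomogB pihomogM1 // pihomog_dE.
Qed.

(** Multiplication by [s] is onto in degree [i + 1], so the multiples of a basis in degree [i]
    generate there. *)
Lemma hilbert_noninc J s i : is_ideal J ->
  (forall p, p \is i.+1.-homog -> exists2 q, q \is i.-homog & J (p - s * q)) ->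
  (hilbert J i.+1 <= hilbert J i)%N.
Proof.
move=> hJ hs; have [f [hf ff gf]] := hilbert_basis i hJ.
apply: (@hilbert_le _ _ _ (fun k => s * f k)) => // p /hs [q /gf [c Jq] Jp]; exists c.
have := idealD hJ Jp (idealM s hJ Jq); congr J.
rewrite mulrBr mulr_sumr addrA subrK; congr (_ - _); apply: eq_bigr => k _.
by rewrite scalerAr.
Qed.

(** Exactness of [0 -> R/(J : L)(-1) -> R/J -> R/(J + (L)) -> 0]: a basis in the middle consists of
    [L] times a basis on the left and lifts of a basis on the right. *)
Lemma hilbert_colon_adjoin J L i : is_homogeneous_ideal J -> L \is 1.-homog ->
  hilbert J i.+1 = (hilbert (colon J L) i + hilbert (adjoin J L) i.+1)%N.
Proof.
move=> gJ hL; have hJ := gJ.1.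
have hC := colon_ideal L hJ; have hP := adjoin_ideal L hJ.
have [f [hf ff gf]] := hilbert_basis i hC; have [g [hg fg gg]] := hilbert_basis i.+1 hP.
apply/hilbert_eq/hilbP => //.
have S (c : 'I_(hilbert (colon J L) i + hilbert (adjoin J L) i.+1) -> K) :
  \sum_k c k *: (match split k with inl a => L * f a | inr b => g b end) =
  L * (\sum_k c (lshift _ k) *: f k) + \sum_k c (rshift _ k) *: g k.
  rewrite big_split_ord /= mulr_sumr; congr (_ + _); apply: eq_bigr => k _.
    by rewrite (unsplitK (inl k)) scalerAr.
  by rewrite (unsplitK (inr k)).
exists (fun k => match split k with inl a => L * f a | inr b => g b end); split.
- by move=> k; case: split => // a; apply: homogM1.
- move=> c; rewrite S => Jc.
  have g0 : forall k, c (rshift _ k) = 0.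
    apply: fg; exists (- \sum_k c (lshift _ k) *: f k).
    by rewrite mulrN opprK addrC.
  have f0 : forall k, c (lshift _ k) = 0.
    by apply: ff; move: Jc; rewrite [X in _ + X]big1 ?addr0 // => k _; rewrite g0 scale0r.
  by move=> k; rewrite -(splitK k); case: (split k).
move=> p hp; have [d Jd] := gg p hp.
have homq : p - \sum_k d k *: g k \is i.+1.-homog.
  by apply: rpredB => //; apply: rpred_sum => k _; apply: rpredZ.
have [a ha Ja] := adjoin_homogP gJ hL homq Jd.
have [e Je] := gf a ha.
exists (fun k => match split k with inl x => e x | inr y => d y end); rewrite S.
under eq_bigr do rewrite (unsplitK (inl _)).
under [\sum_(k < hilbert (adjoin J L) i.+1) _]eq_bigr do rewrite (unsplitK (inr _)).
have := idealD hJ Ja Je; congr J; rewrite mulrBr; ring.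
Qed.

End Ideals.

(** * Gorenstein duality *)

Section Duality.
Variable K : closedFieldType.
Local Notation R := {mpoly K[4]}.
Variables (I : R -> Prop) (j : nat).
Hypotheses (gI : is_homogeneous_ideal I) (socI : gorenstein_socle I).
Hypotheses (hj : hilbert I j <> 0%N) (hgt : forall i, (j < i)%N -> hilbert I i = 0%N).
Let hI : is_ideal I := gI.1.

Lemma top_form : exists2 g0 : R, g0 \is j.-homog & ~ I g0.
Proof.
apply: NNPP => h; apply: hj; apply/hilbert_eq0 => // p hp.
by apply: NNPP => np; apply: h; exists p.
Qed.

(** Since [A] vanishes in degree [j + 1], [g0] lies in the one-dimensional socle; being nonzero in
    [A], it spans it. *)
Lemma socle_top (g0 : R) : g0 \is j.-homog -> ~ I g0 ->
  forall p, in_socle I p -> exists c : K, I (p - c *: g0).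
Proof.
move=> hg ng p sp; have [p0 [_ [_ gen]]] := socI.
have sg : in_socle I g0.
  by move=> k; have /hilbert_eq0 := hgt (ltnSn j); apply=> //; apply: homogM1 => //; apply: homogX.
have [c' Ic'] := gen _ sg; have [c Ic] := gen _ sp.
have c'0 : c' != 0.
  by apply/eqP => c'0; apply: ng; move: Ic'; rewrite c'0 scale0r subr0.
exists (c / c'); have := idealB hI Ic (idealZ (c / c') hI Ic'); congr I.
by rewrite scalerBr scalerA divfK //; ring.
Qed.

(** By descending induction on [i], all ['X_k * f] lie in [I], so [f] is in the socle; but the socle
    lives in degree [j]. *)
Lemma perfect_pairing i (f : R) : (i <= j)%N -> f \is i.-homog ->
  (forall g : R, g \is (j - i).-homog -> I (f * g)) -> I f.
Proof.
move Ed : (j - i)%N => d; elim: d i f Ed => [|d IHd] i f Ed ij hf h.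
  by rewrite -[f]mulr1; apply: h; apply: dhomog1.
have [g0 hg ng] := top_form.
have sf : in_socle I f.
  move=> k; apply: (IHd i.+1); [lia|lia|by apply: homogM1; first exact: homogX|].
  move=> g hg'; rewrite -mulrA mulrCA; apply: h; apply: homogM1 => //; exact: homogX.
have [c Ic] := socle_top hg ng sf.
(* Here [i < j], so in degree [i] the relation loses its multiple of [g0] and leaves [f]. *)
have := gI.2 _ i Ic; rewrite pihomogB linearZ /= pihomog_dE //.
by rewrite (@pihomog_ne0 _ _ _ j) ?scaler0 ?subr0 //; lia.
Qed.

Lemma top_span (g0 : R) : g0 \is j.-homog -> ~ I g0 ->
  forall p, p \is j.-homog -> exists c : K, I (p - c *: g0).
Proof.
move=> hg ng p hp; apply: socle_top => // k.
by have /hilbert_eq0 := hgt (ltnSn j); apply=> //; apply: homogM1 => //; apply: homogX.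
Qed.

(** The form [(f, g) -> G * f * g] pairs degrees [a] and [b] of [R/(I : G)] into the line [A_j]. A
    larger dimension in degree [a] would give a nonzero [F] with [G * F] orthogonal to all of [A_b],
    against [perfect_pairing]. *)
Lemma hilbert_colon_le e a b (G : R) : G \is e.-homog -> (a + b + e = j)%N ->
  (hilbert (colon I G) a <= hilbert (colon I G) b)%N.
Proof.
move=> hG abe; have hC := colon_ideal G hI.
have [f [hf ff _]] := hilbert_basis a hC; have [g [hg _ gg]] := hilbert_basis b hC.
have [g0 hg0 ng0] := top_form; have top := top_span hg0 ng0.
have pair k : exists A, forall l, I (G * f k * g l - A l *: g0).
  suff /fin_all_exists h : forall l, exists A, I (G * f k * g l - A *: g0) by [].
  move=> l; apply: top; by rewrite (_ : j = e + a + b)%N ?dhomogM //; lia.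
have [A hA] := fin_all_exists pair.
rewrite leqNgt; apply/negP => lt.
have [x x0 xA] := row_kernel (\matrix_(k, l) A k l) lt.
case/negP: x0; apply/eqP/rowP => k; rewrite mxE; apply: (ff (fun k => x 0 k)).
pose F := \sum_k x 0 k *: f k; rewrite -/F.
have hF : F \is (a).-homog by apply: rpred_sum => l _; apply: rpredZ.
apply: (@perfect_pairing (e + a)); [lia|exact: dhomogM|].
have IFg l : I (G * F * g l).
  have := ideal_sum (P := xpredT) (index_enum 'I_(hilbert (colon I G) a)) hI
    (fun i _ => idealZ (x 0 i) hI (hA i l)).
  under eq_bigr do rewrite scalerBr scalerA.
  have -> : \sum_i (x 0 i *: (G * f i * g l) - (x 0 i * A i l) *: g0) =
      \sum_i x 0 i *: (G * f i * g l) - (x *m \matrix_(k, l) A k l) 0 l *: g0.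
    rewrite sumrB -scaler_suml mxE; congr (_ - _ *: _).
    by apply: eq_bigr => i _; rewrite mxE.
  rewrite xA mxE scale0r subr0; congr I.
  rewrite /F mulr_sumr mulr_suml; apply: eq_bigr => i _.
  by rewrite -scalerAr -scalerAl.
move=> q; rewrite (_ : j - (e + a) = b)%N; last lia.
move=> /gg [c Ic].
have := idealD hI (idealM F hI Ic) (ideal_sum (P := xpredT) (index_enum 'I_(hilbert (colon I G) b)) hI
  (fun l _ => idealZ (c l) hI (IFg l))).
have -> : \sum_l c l *: (G * F * g l) = G * F * \sum_l c l *: g l.
  by rewrite [RHS]mulr_sumr; apply: eq_bigr => l _; rewrite -scalerAr.
by congr I; ring.
Qed.

Lemma hilbert_colon_sym e a b (G : R) : G \is e.-homog -> (a + b + e = j)%N ->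
  hilbert (colon I G) a = hilbert (colon I G) b.
Proof.
move=> hG abe; apply/eqP; rewrite eqn_leq !(hilbert_colon_le hG) //; lia.
Qed.

Lemma hilbert_sym a b : (a + b = j)%N -> hilbert I a = hilbert I b.
Proof.
move=> ab; have E i : hilbert I i = hilbert (colon I 1) i.
  by apply: hilbert_ext => //; [apply: colon_ideal | move=> p _; rewrite /colon mul1r].
by rewrite !E; apply: (@hilbert_colon_sym 0); [apply: dhomog1 | lia].
Qed.

(** The exact sequences in degrees [i + 1] and [j - i] have equal colon terms by symmetry. The
    resulting formula for the first difference is stated additively to avoid truncated
    subtraction. *)
Lemma hilbert_step L i : L \is 1.-homog -> (i < j)%N ->
  (hilbert I i.+1 + hilbert (adjoin I L) (j - i) = hilbert I i + hilbert (adjoin I L) i.+1)%N.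
Proof.
move=> hL ij; have E : (j - i = (j - i.+1).+1)%N by lia.
have E1 := hilbert_colon_adjoin i gI hL; have E2 := hilbert_colon_adjoin (j - i.+1) gI hL.
have E3 : hilbert (colon I L) i = hilbert (colon I L) (j - i.+1).
  by apply: (hilbert_colon_sym hL); lia.
have E4 : hilbert I i = hilbert I (j - i) by apply: hilbert_sym; lia.
rewrite E in E4 *; lia.
Qed.

(* Modulo L and l the algebra vanishes from degree m on, so multiplication by l
   is surjective on A/LA from degree m - 1 on. *)
Lemma hilbert_adjoin_noninc L l m i : L \is 1.-homog -> l \is 1.-homog ->
  (forall p : R, p \is m.+1.-homog -> adjoin (adjoin I L) l p) -> (m <= i)%N ->
  (hilbert (adjoin I L) i.+1 <= hilbert (adjoin I L) i)%N.
Proof.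
move=> hL hl full mi; have gP := adjoin_homog gI hL.
have full' d p : p \is (m.+1 + d).-homog -> adjoin (adjoin I L) l p.
  elim: d p => [|d IHd] p; first by rewrite addn0; apply: full.
  rewrite addnS => /homog_succ [g [hg ->]]; have hQ := adjoin_ideal l gP.1.
  by apply: ideal_sum => // k _; apply: idealM => //; apply: IHd.
apply: (@hilbert_noninc _ _ l _ gP.1) => p hp.
apply: (adjoin_homogP gP hl) => //; apply: (full' (i - m)%N).
by rewrite (_ : m.+1 + (i - m) = i.+1)%N //; lia.
Qed.

(** With [c] the Hilbert function of [A/LA], [t_(i+1) = c_(i+1) - c_(j-i)] where [i + 1 <= j - i];
    going to [t_(i+2)] lowers the first term and raises the subtracted one. The last inequality is
    [t_(i+2) <= t_(i+1)]. *)
Lemma first_difference_noninc L l m : L \is 1.-homog -> l \is 1.-homog ->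
  (forall p : R, p \is m.+1.-homog -> adjoin (adjoin I L) l p) ->
  forall i, (m <= i.+1)%N -> (i.+1 <= j./2)%N -> (hilbert I i <= hilbert I i.+1)%N /\
    ((i.+2 <= j./2)%N -> (hilbert I i.+2 + hilbert I i <= 2 * hilbert I i.+1)%N).
Proof.
move=> hL hl full i mi ij.
have dec := hilbert_adjoin_noninc hL hl full.
have mono a b : (m <= a)%N -> (a <= b)%N -> (hilbert (adjoin I L) b <= hilbert (adjoin I L) a)%N.
  move=> ma; elim: b => [|b IHb]; first by rewrite leqn0 => /eqP ->.
  rewrite leq_eqVlt => /predU1P [-> //|]; rewrite ltnS => ab.
  by apply: leq_trans (IHb ab); apply: dec; apply: leq_trans ab.
have hij : (i.+1 * 2 <= j)%N by lia.
have S1 := @hilbert_step L i hL; have S2 := @hilbert_step L i.+1 hL.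
have M1 := mono i.+1 (j - i)%N mi; split; first lia.
move=> ij2; have M2 := mono i.+1 i.+2; have M3 := mono (j - i.+1)%N (j - i)%N; lia.
Qed.

End Duality.

(** * Restriction to lines and pencils of quadrics *)

Section Lines.
Variable K : closedFieldType.
Local Notation R := {mpoly K[4]}.
Implicit Types (Q : R -> Prop) (p q r a b : R) (u v : 'I_4 -> K).

(** The matrix [M] with rows [u], [v] has a right inverse [B]; since [M] kills [1 - B M], this
    matrix has rank at most 2. *)
Lemma split_identity (u v : 'I_4 -> K) :
  (forall c d, (forall k, c * u k + d * v k = 0) -> c = 0 /\ d = 0) ->
  exists (B C : 'M[K]_(4, 2)) (D : 'M[K]_(2, 4)), forall i k,
    (i == k)%:R = B i 0 * u k + B i 1 * v k + (C i 0 * D 0 k + C i 1 * D 1 k).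
Proof.
move=> ind; pose M : 'M[K]_(2, 4) := \matrix_(e, k) if e == 0 then u k else v k.
have freeM : row_free M.
  apply/inj_row_free => x /rowP xM; have [x0 x1] : x 0 0 = 0 /\ x 0 1 = 0.
    apply: ind => k; have := xM k; rewrite !mxE !big_ord_recl big_ord0 addr0 !mxE /=.
    by rewrite (_ : (lift ord0 ord0 : 'I_2) = 1) //; apply: val_inj.
  apply/rowP => e; rewrite mxE; have [->|->] // : e = 0 \/ e = 1.
  by case: e => [[|[|//]]] ?; [left|right]; apply: val_inj.
have [B MB] := row_freeP freeM.
pose N := 1%:M - B *m M.
have rN : (\rank N <= 2)%N.
  have : M *m N = 0 by rewrite mulmxBr mulmx1 mulmxA MB mul1mx subrr.
  by move=> /mulmx0_rank_max; rewrite (eqP freeM).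
have [C [D E]] : exists (C : 'M[K]_(4, 2)) (D : 'M[K]_(2, 4)), 1%:M = B *m M + C *m D.
  (* A rank factorization of [N] through dimension 2. *)
  exists (col_ebase N *m pid_mx 2), (pid_mx (\rank N) *m row_ebase N).
  rewrite mulmxA -(mulmxA (col_ebase N)) mul_pid_mx.
  by rewrite (minn_idPr rN) (minn_idPr rN) mulmx_ebase /N addrC subrK.
exists B, C, D => i k; have /matrixP /(_ i k) := E.
rewrite !mxE !big_ord_recl !big_ord0 !addr0 !mxE /=.
by rewrite (_ : (lift ord0 ord0 : 'I_2) = 1) //; apply: val_inj.
Qed.

(** Contracting [split_identity] with the variables gives
    ['X_k = u k a + v k b + D 0 k L + D 1 k l]: the columns of [B] give coordinates on the line,
    those of [C] its equations. *)
Lemma line_equations (u v : 'I_4 -> K) :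
  (forall c d, (forall k, c * u k + d * v k = 0) -> c = 0 /\ d = 0) ->
  exists a b L l : R, [/\ L \is 1.-homog, l \is 1.-homog &
   forall I, is_ideal I -> forall k, adjoin (adjoin I L) l ('X_k - (u k *: a + v k *: b))].
Proof.
move=> /split_identity [B [C [D E]]].
pose form (A : 'M[K]_(4, 2)) e : R := \sum_i A i e *: 'X_i.
have hform A e : form A e \is 1.-homog.
  by apply: rpred_sum => i _; apply: rpredZ; apply: homogX.
exists (form B 0), (form B 1), (form C 0), (form C 1); split=> // I hI k.
have -> : 'X_k - (u k *: form B 0 + v k *: form B 1) =
    form C 0 * (D 0 k)%:MP + form C 1 * (D 1 k)%:MP.
  rewrite ![_ * _%:MP]mulrC !mul_mpolyC; apply/eqP; rewrite subr_eq; apply/eqP.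
  rewrite /form !scaler_sumr -!big_split /= (bigD1 k) //=.
  rewrite !scalerA -!scalerDl [X in X *: 'X_k](_ : _ = 1) ?scale1r; last first.
    by have := E k k; rewrite eqxx /= => E1; apply: etrans (esym E1); ring.
  rewrite big1 ?addr0 // => i /negPf ik; rewrite !scalerA -!scalerDl.
  rewrite [X in X *: 'X_i](_ : _ = 0) ?scale0r //.
  by have := E i k; rewrite ik /= => E0; apply: etrans (esym E0); ring.
have hP := adjoin_ideal (form C 0) hI.
apply: idealD; [exact: adjoin_ideal | | exact: adjoin_gen].
by apply: adjoin_sub => //; apply: adjoin_gen.
Qed.

(** Modulo [Q] the generic point is [a u + b v]: [a] and [b] serve as homogeneous coordinates on the
    line through [u] and [v]. *)
Definition on_line Q u v a b := forall k : 'I_4, Q ('X_k - (u k *: a + v k *: b)).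

Lemma cong_mul Q p p' q q' : is_ideal Q -> Q (p - p') -> Q (q - q') -> Q (p * q - p' * q').
Proof.
move=> hQ hp hq; have := idealD hQ (ideal_mulr q hQ hp) (idealM p' hQ hq).
by congr Q; ring.
Qed.

Lemma on_line_linear Q u v a b (g : R) : is_ideal Q -> on_line Q u v a b ->
  g \is 1.-homog -> Q (g - (g.@[u] *: a + g.@[v] *: b)).
Proof.
move=> hQ ol /homog1 [c ->].
have := ideal_sum (P := xpredT) (index_enum 'I_4) hQ (fun k _ => idealZ (c k) hQ (ol k)).
congr Q; rewrite !raddf_sum /= !scaler_suml -big_split -sumrB; apply: eq_bigr => k _.
by rewrite /= !mevalZ !mevalXU scalerBr scalerDr !scalerA.
Qed.

(* The form a is the polar of q at u, written so as to make sense in characteristic 2. *)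
Lemma on_line_quadratic u q : q \is 2.-homog -> exists2 g : R, g \is 1.-homog &
  (forall c, g.@[fun k => c * u k] = 2%:R * c * q.@[u]) /\
  (forall Q v a b, is_ideal Q -> on_line Q u v a b ->
     Q (q - (q.@[u] *: (a * a) + g.@[v] *: (a * b) + q.@[v] *: (b * b)))).
Proof.
move=> /homog_succ [h [hh ->]].
(* Its value at [v] is the coefficient of [a * b] in the sum of the products
   [(u k a + v k b) (h_k(u) a + h_k(v) b)]. *)
exists (\sum_k (u k *: h k + (h k).@[u] *: 'X_k)).
  by apply: rpred_sum => k _; apply: rpredD; [apply/rpredZ/hh | apply/rpredZ/homogX].
split=> [c|Q v a b hQ ol].
  rewrite !raddf_sum mulr_sumr; apply: eq_bigr => k _ /=.
  by rewrite mevalD !mevalZ mevalM !mevalXU (meval_homog _ _ (hh k)); ring.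
have := ideal_sum (P := xpredT) (index_enum 'I_4) hQ
  (fun k _ => cong_mul hQ (ol k) (on_line_linear hQ ol (hh k))).
congr Q; rewrite !raddf_sum /= !scaler_suml -!big_split -sumrB; apply: eq_bigr => k _.
rewrite /= mevalD !mevalM !mevalZ !mevalXU -!mul_mpolyC !rmorphD !rmorphM /=; ring.
Qed.

(** The nonzero scalar is the resultant of the binary forms [a^2 + s a b + t b^2] and
    [b (e a + f b)]; without a common zero they generate all binary cubics. *)
Lemma cubics_of_resultant Q (a b : R) (s t e f : K) : is_ideal Q ->
  Q (1 *: (a * a) + s *: (a * b) + t *: (b * b)) ->
  Q (0 *: (a * a) + e *: (a * b) + f *: (b * b)) ->
  f ^+ 2 - s * e * f + t * e ^+ 2 != 0 ->
  [/\ Q (a * (a * a)), Q (a * (a * b)), Q (a * (b * b)) & Q (b * (b * b))].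
Proof.
move=> hQ h1 h2; set r := (_ + _) => r0; rewrite scale1r in h1; rewrite scale0r add0r in h2.
have QZ c p : c != 0 -> Q (c *: p) -> Q p.
  by move=> c0 /(idealZ c^-1 hQ); rewrite scalerA mulVf // scale1r.
have h : Q (b * (b * b)).
  apply: (QZ r) => //.
  (* Bezout combination in which [a^2 b] and [a b^2] cancel and [b^3] has coefficient [r]. *)
  have := idealB hQ (idealM (e%:MP ^+ 2 * b) hQ h1)
    (idealM (e%:MP * a + (s%:MP * e%:MP - f%:MP) * b) hQ h2).
  by congr Q; rewrite -!mul_mpolyC /r !rmorphD !rmorphN !rmorphM ?rmorphXn /=; ring.
have h' : Q (a * (b * b)).
  (* If [e = 0] then [r = f^2], so the second quadric is a nonzero multiple of [b^2]. *)
  have [e0|e0] := eqVneq e 0.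
    apply: (QZ f).
      by move: r0; apply: contraNneq; rewrite /r => ->; rewrite e0; apply/eqP; ring.
    by have := idealM a hQ h2; rewrite e0 scale0r add0r -scalerAr.
  apply: (QZ e) => //; have := idealB hQ (idealM b hQ h2) (idealZ f hQ h).
  by congr Q; rewrite -!mul_mpolyC; ring.
have h'' : Q (a * (a * b)).
  have := idealB hQ (idealB hQ (idealM b hQ h1) (idealZ s hQ h')) (idealZ t hQ h).
  by congr Q; rewrite -!mul_mpolyC; ring.
split=> //; have := idealB hQ (idealB hQ (idealM a hQ h1) (idealZ s hQ h'')) (idealZ t hQ h').
by congr Q; rewrite -!mul_mpolyC; ring.
Qed.

Lemma on_line_cubics Q u v a b : is_ideal Q -> on_line Q u v a b ->
  [/\ Q (a * (a * a)), Q (a * (a * b)), Q (a * (b * b)) & Q (b * (b * b))] ->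
  forall p, p \is 3.-homog -> Q p.
Proof.
move=> hQ ol [h0 h1 h2 h3].
have st g : Q (a * g) -> Q (b * g) -> forall p, p \is 1.-homog -> Q (p * g).
  move=> Qa Qb p hp; have := ideal_mulr g hQ (on_line_linear hQ ol hp).
  rewrite mulrBl => /(idealBC hQ); apply.
  have := idealD hQ (idealZ p.@[u] hQ Qa) (idealZ p.@[v] hQ Qb).
  by congr Q; rewrite mulrDl -!scalerAl.
have st2 g : (forall p, p \is 1.-homog -> Q (p * (a * g))) ->
    (forall p, p \is 1.-homog -> Q (p * (b * g))) ->
    forall p, p \is 2.-homog -> Q (p * g).
  move=> Qa Qb p /homog_succ [h [hh ->]]; rewrite mulr_suml.
  apply: ideal_sum => // k _; rewrite (mulrC 'X_k) -mulrA; rewrite mulrCA.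
  by apply: st; rewrite ?homogX // mulrCA; [apply: Qa | apply: Qb].
move=> p /homog_succ [h [hh ->]]; apply: ideal_sum => // k _.
apply: (st); rewrite ?homogX // mulrC; apply: (st2) => // q hq; apply: (st) => //.
all: by rewrite ?(mulrC b a) ?(mulrCA b a) ?(mulrC b a).
Qed.

(** If no line works, every [q] in [I_2] vanishing at [P] satisfies [q^2 - g0 g q + q0 g^2 = 0].
    Then [g] divides [q], and [m = q / g] gives a splitting [q0 = m (g0 - m)]; so each [q] is
    divisible by one of two fixed linear forms. *)
Lemma quadric_dichotomy (I : R -> Prop) (q1 q2 : R) : is_ideal I ->
  q1 \is 2.-homog -> I q1 -> q1 != 0 ->
  q2 \is 2.-homog -> I q2 -> (forall c, q2 != c *: q1) ->
  (exists w : R, [/\ w \is 1.-homog, w != 0 &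
     forall q, q \is 2.-homog -> I q -> exists g, q = w * g]) \/
  (exists L l : R, [/\ L \is 1.-homog, l \is 1.-homog &
     forall p, p \is 3.-homog -> adjoin (adjoin I L) l p]).
Proof.
move=> hI hq1 Iq1 nq1 hq2 Iq2 nq2.
case: (classic (exists L l : R, [/\ L \is 1.-homog, l \is 1.-homog &
     forall p, p \is 3.-homog -> adjoin (adjoin I L) l p])) => [|nLl]; first by right.
left; have [P q1P] : exists P, q1.@[P] != 0.
  apply: NNPP => nP; move/eqP: nq1; apply; apply: meval_eq0 => v.
  by apply/eqP/negPn/negP => ?; apply: nP; exists v.
(* Normalized to value 1 at [P], [q0] restricts to lines through [P] as a quadric monic in [a]. *)
pose q0 := (q1.@[P])^-1 *: q1.
have hq0 : q0 \is 2.-homog by apply: rpredZ.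
have Iq0 : I q0 by apply: idealZ.
have q0P : q0.@[P] = 1 by rewrite mevalZ mulVf.
have [g0 hg0 [g0P g0Q]] := on_line_quadratic P hq0.
have factor q : q \is 2.-homog -> I q -> q.@[P] = 0 -> q != 0 ->
    exists g m, [/\ m \is 1.-homog, q = m * g & q0 = m * (g0 - m)].
  move=> hq Iq qP nq; have [g hg [gP gQ]] := on_line_quadratic P hq.
  have res v : q.@[v] ^+ 2 - g0.@[v] * g.@[v] * q.@[v] + q0.@[v] * g.@[v] ^+ 2 = 0.
    apply/eqP/contraT => r0; exfalso; apply: nLl.
    have [ind|] := classic (forall c d, (forall k, c * P k + d * v k = 0) -> c = 0 /\ d = 0).
      have [a [b [L [l [hL hl /(_ I hI) ol]]]]] := line_equations ind.
      exists L, l; split=> //.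
      have hQ := adjoin_ideal l (adjoin_ideal L hI).
      have sub p : I p -> adjoin (adjoin I L) l p.
        by move=> Ip; apply: adjoin_sub; [apply: adjoin_ideal | apply: adjoin_sub].
      apply: (on_line_cubics hQ ol); apply: cubics_of_resultant r0 => //.
        have := idealB hQ (sub _ Iq0) (g0Q _ _ _ _ hQ ol); congr adjoin.
        by rewrite q0P; ring.
      have := idealB hQ (sub _ Iq) (gQ _ _ _ _ hQ ol); congr adjoin.
      by rewrite qP; ring.
    (* When [v] and [P] are dependent there is no line, but [v] is a multiple of [P], where both [q]
       and [g] vanish. *)
    move=> /not_all_ex_not [c] /not_all_ex_not [d] nind.
    have [cd ncd] := imply_to_and _ _ nind.
    case/negP: r0; apply/eqP.
    have d0 : d != 0.
      apply/eqP => d0; apply: ncd; split=> //; apply/eqP/contraT => c0.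
      have P0 k : P k = 0 * P k.
        have /eqP := cd k; rewrite d0 !mul0r addr0 mulf_eq0 (negPf c0) /=.
        by move/eqP.
      have := q0P; rewrite (meval_eq _ P0) (meval_homog _ _ hq0) expr0n mul0r => /esym/eqP.
      by rewrite oner_eq0.
    have vP k : v k = - (c / d) * P k.
      have /eqP := cd k; rewrite addrC addr_eq0 => /eqP E.
      by rewrite mulNr mulrAC -mulNr -E mulrAC mulfV // mul1r.
    have -> : g.@[v] = 0 by rewrite (meval_eq _ vP) gP qP mulr0.
    by rewrite (meval_eq q vP) (meval_homog _ _ hq) qP; ring.
  have resP : q ^+ 2 - g0 * g * q + q0 * g ^+ 2 = 0.
    apply: meval_eq0 => v; rewrite -[RHS](res v).
    by rewrite mevalD mevalB !mevalM.
  have g_neq0 : g != 0.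
    apply: contraNneq nq => gE; move/eqP: resP.
    by rewrite gE mulr0 mul0r subr0 expr0n mulr0 addr0 expf_eq0.
  (* At zeros of [g] the identity reduces to [q^2 = 0]. *)
  have [v0|m Em] := @linear_form_dvd _ _ g q hg g_neq0.
    move=> gv; have /eqP := res v0; rewrite gv.
    by rewrite mulr0 mul0r subr0 expr0n mulr0 addr0 expf_eq0 => /eqP.
  have {m Em} [m hm Em] := @homog_dvd _ _ 1 1 g q m hg hq Em.
  exists g, m; split=> //; first by rewrite mulrC.
  apply/eqP; rewrite -subr_eq0; have := resP.
  rewrite Em (_ : _ + _ = g ^+ 2 * (q0 - m * (g0 - m))); last by ring.
  by move/eqP; rewrite mulf_eq0 expf_eq0 (negPf g_neq0).
have [g [m [hm _ Eq0]]] : exists g m,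
    [/\ m \is 1.-homog, q2 - q2.@[P] *: q0 = m * g & q0 = m * (g0 - m)].
  apply: factor; first by apply: rpredB => //; apply: rpredZ.
  - by apply: idealB => //; apply: idealZ.
  - by rewrite mevalB mevalZ q0P mulr1 subrr.
  by rewrite subr_eq0 scalerA.
have q0_neq0 : q0 != 0 by rewrite scaler_eq0 invr_eq0 negb_or q1P.
have [m0 n0] : m != 0 /\ g0 - m != 0.
  by apply/andP; rewrite -negb_or -mulf_eq0 -Eq0.
have hn : g0 - m \is 1.-homog by apply: rpredB.
have common w : w \is 1.-homog -> w != 0 -> (exists g, q0 = w * g) ->
    (forall q, q \is 2.-homog -> I q -> q.@[P] = 0 -> exists g, q = w * g) ->
    exists w, [/\ w \is 1.-homog, w != 0 &
     forall q, q \is 2.-homog -> I q -> exists g, q = w * g].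
  move=> hw w0 [g' Eg'] dvd; exists w; split=> // q hq Iq.
  have [|||g'' E] := dvd (q - q.@[P] *: q0).
  - by apply: rpredB => //; apply: rpredZ.
  - by apply: idealB => //; apply: idealZ.
  - by rewrite mevalB mevalZ q0P mulr1 subrr.
  exists (g'' + q.@[P] *: g'); rewrite mulrDr -E -scalerAr -Eg'; by rewrite subrK.
have either q : q \is 2.-homog -> I q -> q.@[P] = 0 ->
    (exists g, q = m * g) \/ (exists g, q = (g0 - m) * g).
  move=> hq Iq qP; have [->|nq] := eqVneq q 0; first by left; exists 0; rewrite mulr0.
  have [g' [m' [_ -> E]]] := factor q hq Iq qP nq.
  (* Both [m] and [m'] are roots of [X^2 - g0 X + q0], whose roots are [m] and [g0 - m]. *)
  have : (m' - m) * (g0 - m - m') == 0.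
    have -> : (m' - m) * (g0 - m - m') = m' * (g0 - m') - m * (g0 - m) by ring.
    by rewrite -E -Eq0 subrr.
  rewrite mulf_eq0 => /orP [] ; rewrite subr_eq0 => /eqP; first by move=> ->; left; exists g'.
  by move=> <-; right; exists g'.
have [allm|] := classic (forall q, q \is 2.-homog -> I q -> q.@[P] = 0 -> exists g, q = m * g).
  by apply: (common m) => //; exists (g0 - m).
move=> /not_all_ex_not [qa] nq.
have [hqa {}nq] := imply_to_and _ _ nq; have [Iqa {}nq] := imply_to_and _ _ nq.
have [qaP nqa] := imply_to_and _ _ nq.
apply: (common (g0 - m)) => //; first by exists m; rewrite mulrC.
move=> q hq Iq qP; have [[g1 E1]|//] := either q hq Iq qP.
have [//|[g2 E2]] := either qa hqa Iqa qaP.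
(* A vector space is not the union of two proper subspaces: [q + qa] cannot be a multiple of [m],
   since [q] is and [qa] is not. *)
have [||||] := either (q + qa).
- exact: rpredD.
- exact: idealD.
- by rewrite mevalD qP qaP addr0.
- by move=> [g3 E3]; case: nqa; exists (g3 - g1); rewrite mulrBr -E3 -E1; ring.
by move=> [g3 E3]; exists (g3 - g2); rewrite mulrBr -E3 -E2; ring.
Qed.

End Lines.

(** * Quadrics with a common linear factor *)

Section CommonFactor.
Variable K : closedFieldType.
Local Notation R := {mpoly K[4]}.
Implicit Types (J : R -> Prop) (p q f w : R).

Lemma hilbert_mono J J' i : is_ideal J -> is_ideal J' ->
  (forall p, p \is i.-homog -> J p -> J' p) -> (hilbert J' i <= hilbert J i)%N.
Proof.
move=> hJ hJ' JJ'; have [f [hf _ gf]] := hilbert_basis i hJ.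
apply: (@hilbert_le _ _ _ _ f) => // p hp; have [c Jc] := gf p hp; exists c.
apply: JJ' => //; apply: rpredB => //; apply: rpred_sum => k _; apply/rpredZ/hf.
Qed.

(** The hypothesis says that [J] has dimension at least 2 in degree [i]. Otherwise [z] and a basis
    modulo [J] would generate all forms of degree [i]. *)
Lemma exists_nonmultiple J i (z : R) : is_ideal J -> ((hilbert J i).+1 < 'C(i + 3, i))%N ->
  exists x, [/\ x \is i.-homog, J x & forall c, x != c *: z].
Proof.
move=> hJ; rewrite -(hilbert_zero K) ltnNge => /negP lt; apply: NNPP => nx; apply: lt.
have [f [hf _ gf]] := hilbert_basis i hJ.
apply: (@hilbert_le _ _ _ _ (fun k => if unlift ord0 k is Some k' then f k' else z)).
  by case: (zero_idealP K).
move=> p hp; have [c Jc] := gf p hp.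
have hq : p - \sum_k c k *: f k \is i.-homog.
  by apply: rpredB => //; apply: rpred_sum => k _; apply/rpredZ/hf.
have [e E] : exists e, p - \sum_k c k *: f k = e *: z.
  apply: NNPP => ne; apply: nx; exists (p - \sum_k c k *: f k); split=> // e.
  by apply/eqP => E; apply: ne; exists e.
exists (fun k => if unlift ord0 k is Some k' then c k' else e).
rewrite /zero_ideal big_ord_recl unlift_none /= -E opprD opprB addrCA addrA.
rewrite addrC [X in - X](_ : _ = \sum_k c k *: f k); first by ring.
by apply: eq_bigr => k _; rewrite liftK.
Qed.

(** As [w] is a nonzerodivisor, the colon term is that of the polynomial ring, and Pascal's rule
    gives the difference. *)
Lemma hilbert_hyperplane w i : w \is 1.-homog -> w != 0 ->
  hilbert (adjoin (@zero_ideal K) w) i.+1 = 'C(i + 3, 2).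
Proof.
move=> hw w0; have [hZ gZ] := zero_idealP K.
have := hilbert_colon_adjoin i (zero_idealP K) hw.
have -> : hilbert (colon (@zero_ideal K) w) i = hilbert (@zero_ideal K) i.
  apply: hilbert_ext => // [|p _]; first exact: colon_ideal.
  rewrite /colon /zero_ideal; split=> [/eqP|->]; last by rewrite mulr0.
  by rewrite mulf_eq0 (negPf w0) => /eqP.
rewrite !hilbert_zero addSn binS addnC => /addnI <-.
by rewrite -[RHS]bin_sub; [congr binomial; lia | lia].
Qed.

(** In degree [i + 1] the ideals [J + (w)] and [(w)] coincide. *)
Lemma hilbert_common_factor J w i : is_homogeneous_ideal J -> w \is 1.-homog -> w != 0 ->
  (forall p, p \is i.+1.-homog -> J p -> exists g, p = w * g) ->
  hilbert J i.+1 = (hilbert (colon J w) i + 'C(i + 3, 2))%N.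
Proof.
move=> gJ hw w0 dvd; rewrite (hilbert_colon_adjoin i gJ hw) -(hilbert_hyperplane i hw w0).
congr addn; apply: hilbert_ext; [exact: adjoin_ideal gJ.1 | exact: adjoin_ideal (zero_idealP K).1 |].
move=> p hp; split=> [Jp|[a /eqP]]; last first.
  by rewrite subr_eq0 => /eqP ->; apply: adjoin_gen gJ.1.
have [a ha Ja] := adjoin_homogP gJ hw hp Jp.
have [|g E] := dvd _ _ Ja; first by apply: rpredB => //; apply: homogM1.
by exists (g + a); rewrite mulrDr -E subrK; apply: subrr.
Qed.

(* On the line through u and v, w restricts to b, and w x, w y to a b and b ^+ 2;
   the form f adds the remaining monomial. *)
Lemma line_of_common_factor (I : R -> Prop) w x y f d : is_ideal I ->
  w \is 1.-homog -> w != 0 -> x \is 1.-homog -> y \is 1.-homog ->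
  I (w * x) -> I (w * y) ->
  (forall c, x != c *: w) -> (forall c, y != c *: x) ->
  f \is d.+2.-homog -> I f -> ~ (exists g, f = w * g) ->
  exists L l : R, [/\ L \is 1.-homog, l \is 1.-homog &
     forall p, p \is d.+2.-homog -> adjoin (adjoin I L) l p].
Proof.
move=> hI hw w0 hx hy Iwx Iwy xw yx hf If nf.
have ndvd p q : p \is 1.-homog -> q \is 1.-homog -> (forall c, q != c *: p) ->
    ~ exists g, q = p * g.
  move=> hp hq nq [g E]; have [g' /homog0 [c ->] E'] := @homog_dvd _ _ 1 0 p q g hp hq E.
  by case/negP: (nq c); rewrite E' mulrC mul_mpolyC.
have x0 : x != 0 by have := xw 0; rewrite scale0r.
have nw c : w != c *: x.
  apply/eqP => E; have c0 : c != 0 by apply: contraNneq w0 => c0; rewrite E c0 scale0r.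
  by case/negP: (xw c^-1); rewrite E scalerA mulVf // scale1r.
(* The choices make [w] a nonzero multiple of [b] on the line, [x] one of [a], and give [y] a
   nonzero coefficient at [b]. *)
have [v [wv fv xv]] := linear_form_ndvd2 hw w0 nf (ndvd _ _ hw hx xw).
have [u [xu wu yu]] := linear_form_ndvd2 hx x0 (ndvd _ _ hx hw nw) (ndvd _ _ hx hy yx).
have ind c e : (forall k, c * v k + e * u k = 0) -> c = 0 /\ e = 0.
  move=> cd; have ev p : p \is 1.-homog -> c * p.@[v] + e * p.@[u] = 0.
    move=> /homog1 [r ->]; rewrite !raddf_sum !mulr_sumr -big_split big1 // => k _ /=.
    by rewrite !mevalZ !mevalXU mulrCA (mulrCA e) -mulrDr cd mulr0.
  have /eqP := ev w hw; rewrite wv mulr0 add0r mulf_eq0 (negPf wu) orbF => /eqP e0.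
  have /eqP := ev x hx; rewrite xu mulr0 addr0 mulf_eq0 (negPf xv) orbF => /eqP c0.
  by [].
have [a [b [L [l [hL hl /(_ I hI) ol]]]]] := line_equations ind.
exists L, l; split=> //; set Q := adjoin (adjoin I L) l in ol *.
have hQ : is_ideal Q by apply: adjoin_ideal; apply: adjoin_ideal.
have sub p : I p -> Q p by move=> Ip; apply: adjoin_sub; [apply: adjoin_ideal|apply: adjoin_sub].
have QZ c p : c != 0 -> Q (c *: p) -> Q p.
  by move=> c0 /(idealZ c^-1 hQ); rewrite scalerA mulVf // scale1r.
have Qab : Q (a * b).
  apply: (QZ (w.@[u] * x.@[v])); first by rewrite mulf_neq0.
  have := idealB hQ (sub _ Iwx) (cong_mul hQ (on_line_linear hQ ol hw) (on_line_linear hQ ol hx)).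
  by congr Q; rewrite wv xu !scale0r add0r addr0 -!mul_mpolyC rmorphM /=; ring.
have Qbb : Q (b * b).
  apply: (QZ (w.@[u] * y.@[u])); first by rewrite mulf_neq0.
  have := idealB hQ (idealB hQ (sub _ Iwy)
    (cong_mul hQ (on_line_linear hQ ol hw) (on_line_linear hQ ol hy)))
    (idealZ (w.@[u] * y.@[v]) hQ Qab).
  by congr Q; rewrite wv !scale0r add0r -!mul_mpolyC !rmorphM /=; ring.
(* Modulo [a b] and [b^2] only the power of [a] survives; its coefficient is the value at [v], the
   point with coordinates [a = 1], [b = 0]. *)
have power e p : p \is e.+2.-homog -> Q (p - p.@[v] *: a ^+ e.+2).
  elim: e p => [|e IHe] p.
    move=> /homog_succ [h [hh ->]].
    have := ideal_sum (P := xpredT) (index_enum 'I_4) hQ (fun k _ => idealD hQ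
      (cong_mul hQ (ol k) (on_line_linear hQ ol (hh k)))
      (idealD hQ (idealZ (v k * (h k).@[u] + u k * (h k).@[v]) hQ Qab)
                 (idealZ (u k * (h k).@[u]) hQ Qbb))).
    congr Q; rewrite raddf_sum scaler_suml -sumrB; apply: eq_bigr => k _ /=.
    by rewrite mevalM mevalXU -!mul_mpolyC !rmorphD !rmorphM /=; ring.
  move=> /homog_succ [h [hh ->]].
  have := ideal_sum (P := xpredT) (index_enum 'I_4) hQ (fun k _ => idealD hQ
      (cong_mul hQ (ol k) (IHe _ (hh k)))
      (idealM ((u k * (h k).@[v]) *: a ^+ e.+1) hQ Qab)).
  congr Q; rewrite raddf_sum scaler_suml -sumrB; apply: eq_bigr => k _ /=.
  by rewrite mevalM mevalXU -!mul_mpolyC !rmorphM !exprS /=; ring.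
have Qa : Q (a ^+ d.+2).
  by apply: (QZ f.@[v]) => //; have := idealB hQ (sub _ If) (power _ _ hf); congr Q; ring.
move=> p hp; apply: (idealBC hQ (power _ _ hp)); exact: idealZ.
Qed.

(** * Gorenstein ideals whose quadrics share a linear factor *)

Section Gorenstein.
Variables (I : R -> Prop) (w : R).
Hypotheses (gI : is_homogeneous_ideal I) (h2 : hilbert I 2 = 7%N).
Hypotheses (hw : w \is 1.-homog) (w0 : w != 0).
Hypothesis dvd2 : forall q, q \is 2.-homog -> I q -> exists g, q = w * g.
Let hI : is_ideal I := gI.1.
Let hC : is_ideal (colon I w) := colon_ideal w gI.1.

Lemma hilbert_colon1 : hilbert (colon I w) 1 = 1%N.
Proof. by have := hilbert_common_factor gI hw w0 dvd2; rewrite h2 (_ : 'C(1 + 3, 2) = 6%N) //; lia. Qed.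

Lemma colon1_gen : exists2 s : R, s \is 1.-homog &
  forall p, p \is 1.-homog -> exists c, colon I w (p - c *: s).
Proof.
have := hilbert_basis 1 hC; rewrite hilbert_colon1 => -[f [hf _ gf]].
exists (f 0) => // p /gf [c]; rewrite big_ord1 => h; by exists (c 0).
Qed.

(** The linear forms of [I : w] have dimension [4 - 1 = 3], which leaves room for the [x] and [y] of
    [line_of_common_factor]. *)
Lemma line_of_extra_form d f : f \is d.+2.-homog -> I f -> ~ (exists g, f = w * g) ->
  exists L l : R, [/\ L \is 1.-homog, l \is 1.-homog &
     forall p, p \is d.+2.-homog -> adjoin (adjoin I L) l p].
Proof.
move=> hf If nf; have large : ((hilbert (colon I w) 1).+1 < 'C(1 + 3, 1))%N by rewrite hilbert_colon1.
have [x [hx Iwx xw]] := exists_nonmultiple w hC large.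
have [y [hy Iwy yx]] := exists_nonmultiple x hC large.
exact: (line_of_common_factor hI hw w0 hx hy Iwx Iwy xw yx hf If nf).
Qed.

Variable j : nat.
Hypotheses (socI : gorenstein_socle I) (h1 : hilbert I 1 = 4%N).
Hypotheses (hj : hilbert I j <> 0%N) (hgt : forall i, (j < i)%N -> hilbert I i = 0%N).

(** Modulo [I : w] all linear forms are multiples of [s], so the values are at most 1 and
    nonincreasing from degree 1. Symmetry carries positivity from degree 0 to degree [j - 1], hence
    to all degrees between. *)
Lemma hilbert_colon_eq1 i : (i.+1 <= j)%N -> hilbert (colon I w) i = 1%N.
Proof.
have [s hs gs] := colon1_gen.
have dec m : (hilbert (colon I w) m.+2 <= hilbert (colon I w) m.+1)%N.
  apply: (@hilbert_noninc _ _ s) => // p /homog_succ [g [hg ->]].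
  have /fin_all_exists [c hc] k := gs _ (homogX K k).
  exists (\sum_k c k *: g k); first by apply: rpred_sum => k _; apply/rpredZ/hg.
  rewrite mulr_sumr -sumrB; apply: ideal_sum => // k _.
  by have := ideal_mulr (g k) hC (hc k); congr (colon I w); rewrite mulrBl -scalerAl scalerAr.
have ub m : (hilbert (colon I w) m.+1 <= 1)%N.
  elim: m => [|m IHm]; first by rewrite hilbert_colon1.
  exact: leq_trans (dec m) IHm.
have k0 : (0 < hilbert (colon I w) 0)%N.
  (* Otherwise [w] lies in [I], and [A] has dimension at most 3 in degree 1. *)
  rewrite lt0n; apply/negP => /eqP k0.
  have := hilbert_colon_adjoin 0 gI hw; rewrite h1 k0.
  have : (hilbert (adjoin I w) 1 <= hilbert (adjoin (@zero_ideal K) w) 1)%N.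
    apply: hilbert_mono; [exact: adjoin_ideal (zero_idealP K).1 | exact: adjoin_ideal |].
    move=> p _ [a /eqP]; rewrite subr_eq0 => /eqP ->; exact: adjoin_gen.
  by rewrite hilbert_hyperplane // (_ : 'C(0 + 3, 2) = 3%N) //; lia.
have sym a b : (a + b).+1 = j -> hilbert (colon I w) a = hilbert (colon I w) b.
  by move=> ab; apply: (hilbert_colon_sym gI socI hj hgt hw); lia.
have lb m : (m.+2 <= j)%N -> (0 < hilbert (colon I w) m.+1)%N.
  move=> mj; have : (0 < hilbert (colon I w) j.-1)%N by rewrite -(sym 0%N) //; lia.
  have -> : j.-1 = (m.+1 + (j - m.+2))%N by lia.
  elim: (j - m.+2)%N => [|e IHe]; first by rewrite addn0.
  by rewrite addnS addSn => /leq_trans/(_ (dec _)); rewrite -addSn.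
have pos m : (m.+1 <= j)%N -> hilbert (colon I w) m.+1 = 1%N \/ m.+1 = j.
  move=> mj; have [mj'|mj'] := leqP m.+2 j; last by right; lia.
  by left; apply/eqP; rewrite eqn_leq ub lb.
case: i => [|i] ij; last by apply/eqP; rewrite eqn_leq ub lb.
have [j1|j1] := leqP 2 j; last first.
  by have := hgt j1; rewrite h2.
rewrite (sym 0%N (j.-2).+1); last lia.
by apply/eqP; rewrite eqn_leq ub lb //; lia.
Qed.

Lemma hilbert_before i : (i.+1 < j)%N ->
  (forall p, p \is i.+1.-homog -> I p -> exists g, p = w * g) ->
  hilbert I i.+1 = ('C(i + 3, 2)).+1.
Proof. by move=> ij /(hilbert_common_factor gI hw w0) ->; rewrite hilbert_colon_eq1 //; lia. Qed.

End Gorenstein.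
End CommonFactor.

(** * O-sequences *)

(** The expansion has [c] terms [C(i, i) = 1] at the top and [C(i - 1, i) = 0] below; both kinds
    keep their value when the indices are raised. *)
Lemma macaulay_upper_le c d : (0 < d)%N -> (c <= d)%N -> macaulay_upper c d c.
Proof.
move=> d0 cd; have [->|c0] := posnP c; first by left.
right; split=> //; exists (fun i => if (i <= d - c)%N then i.-1 else i); split.
  by move=> i i0 id; case: ifP => h; case: ifP => h'; lia.
have E e : (\sum_(1 <= i < d.+1)
    'C((if (i <= d - c)%N then i.-1 else i) + e, i + e) = c)%N.
  rewrite (@big_cat_nat _ _ _ (d - c).+1) //=; last by lia.
  rewrite big_nat big1 => [|i /andP [i0 id]]; last first.
    have -> : (i <= d - c)%N by lia.
    by rewrite bin_small //; lia.
  rewrite big_nat (eq_bigr (fun=> 1%N)) => [|i /andP [i0 id]]; last first.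
    have -> : (i <= d - c)%N = false by lia.
    by rewrite binn.
  by rewrite -big_nat sum_nat_const_nat muln1; lia.
split; first by rewrite -[LHS](E 0%N); apply: eq_bigr => i _; rewrite !addn0.
by rewrite -[LHS](E 1%N); apply: eq_bigr => i _; rewrite !addn1.
Qed.

(** The expansion is [C(d + 1, d)] followed by zeros, raised to [C(d + 2, d + 1)]. *)
Lemma macaulay_upper_succ d : (0 < d)%N -> macaulay_upper d.+1 d d.+2.
Proof.
move=> d0; right; split=> //; exists (fun i => if i == d then d.+1 else i.-1); split.
  by move=> i i0 id; case: ifP => h; case: ifP => h'; lia.
have E e : (\sum_(1 <= i < d.+1)
    'C((if i == d then d.+1 else i.-1) + e, i + e) = d.+1 + e)%N.
  rewrite big_nat_recr //= eqxx big_nat big1 => [|i /andP [i0 id]].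
    by rewrite add0n addSn binSn.
  have -> : (i == d) = false by lia.
  by rewrite bin_small //; lia.
split; first by rewrite -[LHS]addn0 -(E 0%N); apply: eq_bigr => i _; rewrite !addn0.
by rewrite -[LHS]addn1 -(E 1%N); apply: eq_bigr => i _; rewrite !addn1.
Qed.

(** The growth from [d + 1] to [d + 2] below [m] is exactly Macaulay's bound. From [m] on,
    [t_d <= d + 1], and for such values the bound is at least [t_d] itself. *)
Lemma O_sequence_crit (t : seq int) (m : nat) : (2 <= m)%N ->
  nth 0 t 0 = 1 -> ((1 < size t)%N -> nth 0 t 1 = 3) -> ((2 < size t)%N -> nth 0 t 2 = 3) ->
  (forall i, (2 <= i <= m)%N -> (i < size t)%N -> nth 0 t i = i.+1%:Z) ->
  (forall i, (m <= i)%N -> (i < size t)%N -> 0 <= nth 0 t i) ->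
  (forall i, (m <= i)%N -> (i.+1 < size t)%N -> nth 0 t i.+1 <= nth 0 t i) ->
  O_sequence t.
Proof.
move=> m2 t0 t1 t2 tlow tpos tdec; split=> //; split=> [i it|d d0 dt].
  case: i it => [|[|i]] it; [by rewrite t0|by rewrite t1|].
  have [le|lt] := leqP i.+2 m; first by rewrite tlow.
  by apply: tpos => //; apply: ltnW.
have [d1|d2] := leqP d 1.
  have {d0 d1} d1 : d = 1%N by lia.
  (* [3 = C(3, 1)] is raised to [C(4, 2) = 6]. *)
  exists 6%N; rewrite d1 in dt *; split; last by rewrite t2.
  rewrite t1; last lia; right; split=> //; exists (fun=> 3%N); split; first by lia.
  by rewrite !big_nat1.
have [dm|md] := ltnP d m.
  exists d.+2; rewrite !tlow //; try lia.
  split; last by lia.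
  by apply: macaulay_upper_succ; lia.
have bound : nth 0 t d <= d.+1%:Z.
  have : nth 0 t m <= m.+1%:Z by rewrite tlow //; lia.
  move=> h; have [e Ee] : exists e, d = (m + e)%N by exists (d - m)%N; lia.
  have {dt} dt : (d < size t)%N by lia.
  rewrite {}Ee {d d0 d2 md} in dt *; elim: e dt => [|e IHe] dt; first by rewrite addn0.
  rewrite addnS in dt *; have := tdec (m + e)%N; have := IHe; lia.
have nn : 0 <= nth 0 t d by apply: tpos; lia.
have dec := tdec d md dt.
have [le|lt] := leqP (absz (nth 0 t d)) d.
  exists (absz (nth 0 t d)); split; first exact: macaulay_upper_le.
  by rewrite gez0_abs.
have -> : absz (nth 0 t d) = d.+1 by lia.
exists d.+2; split; first exact: macaulay_upper_succ.
by lia.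
Qed.

Theorem theorem4p2 (K : closedFieldType) (H : seq nat) (j : nat) :
  gorenstein_sequence K H j ->
  nth 0%N H 0 = 1%N -> nth 0%N H 1 = 4%N -> nth 0%N H 2 = 7%N ->
  O_sequence (deltaH_half H j).
Proof.
move=> [sH [nHj [I [gI [socI hilbI]]]]] H0 H1 H2.
have hI : is_ideal I := gI.1.
have hilbertE i : nth 0%N H i = hilbert I i by apply/esym/hilbert_eq.
have hj : hilbert I j <> 0%N by rewrite -hilbertE.
have hgt i : (j < i)%N -> hilbert I i = 0%N by move=> ji; rewrite -hilbertE nth_default // sH.
have h1 : hilbert I 1 = 4%N by rewrite -hilbertE.
have h2 : hilbert I 2 = 7%N by rewrite -hilbertE.
have szt : size (deltaH_half H j) = (j./2).+1 by rewrite size_map size_iota.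
have tE i : (i <= j./2)%N -> nth 0 (deltaH_half H j) i = deltaH H i.
  by move=> ij; rewrite (nth_map 0%N) ?size_iota // nth_iota.
have tS i : (i < j./2)%N -> nth 0 (deltaH_half H j) i.+1 = (hilbert I i.+1)%:Z - (hilbert I i)%:Z.
  by move=> ij; rewrite tE // /deltaH !hilbertE.
have t0 : nth 0 (deltaH_half H j) 0 = 1 by rewrite tE // /deltaH H0.
have t1 : (1 < size (deltaH_half H j))%N -> nth 0 (deltaH_half H j) 1 = 3.
  by rewrite szt => it; rewrite tS // h1 -hilbertE H0.
have t2 : (2 < size (deltaH_half H j))%N -> nth 0 (deltaH_half H j) 2 = 3.
  by rewrite szt => it; rewrite tS // h2 h1.
have tail m : (0 < m)%N -> (exists L l : {mpoly K[4]}, [/\ L \is 1.-homog, l \is 1.-homog &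
     forall p, p \is m.+1.-homog -> adjoin (adjoin I L) l p]) ->
   (forall i, (m <= i)%N -> (i < size (deltaH_half H j))%N ->
      0 <= nth 0 (deltaH_half H j) i) /\
   (forall i, (m <= i)%N -> (i.+1 < size (deltaH_half H j))%N ->
      nth 0 (deltaH_half H j) i.+1 <= nth 0 (deltaH_half H j) i).
  move=> m0 [L [l [hL hl full]]].
  have D := first_difference_noninc gI socI hj hgt hL hl full.
  rewrite szt; split=> [[|i] mi ij|[|i] mi ij]; try lia.
    by have [] := D i mi; [lia | rewrite tS; lia].
  by have [] := D i mi; [lia | rewrite !tS; lia].
(* There are [10 - 7 = 3] independent quadrics in [I]. *)
have large : ((hilbert I 2).+1 < 'C(2 + 3, 2))%N by rewrite h2.
have [q1 [hq1 Iq1 q1n]] := exists_nonmultiple 0 hI large.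
have [q2 [hq2 Iq2 q2n]] := exists_nonmultiple q1 hI large.
have q10 : q1 != 0 by have := q1n 0; rewrite scaler0.
have [[w [hw w0 dvd2]]|line] := quadric_dichotomy hI hq1 Iq1 q10 hq2 Iq2 q2n; last first.
  have [tpos tdec] := @tail 2 isT line.
  apply: (@O_sequence_crit _ 2) => // i i2 it.
  by have -> : i = 2%N by [lia]; rewrite t2 //; lia.
(* The count starts in degree 3, since [w] divides all quadrics of [I]. *)
pose extra d := exists f, [/\ f \is d.+3.-homog, I f & ~ exists g, f = w * g].
have least n : (forall d, (d < n)%N -> ~ extra d) \/
    (exists2 d, extra d & forall d', (d' < d)%N -> ~ extra d').
  elim: n => [|n [IHn|]]; [by left| |by right].
  have [ex|nex] := classic (extra n); first by right; exists n.
  by left=> d; rewrite ltnS leq_eqVlt => /predU1P [->|/IHn].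
have low n : (forall d, (d < n)%N -> ~ extra d) -> forall i, (2 <= i <= n.+2)%N ->
    (i < size (deltaH_half H j))%N -> nth 0 (deltaH_half H j) i = i.+1%:Z.
  move=> nex i /andP [i2 id] it.
  have dvd e : (e <= n)%N -> forall p, p \is e.+2.-homog -> I p -> exists g, p = w * g.
    case: e => [|e] en; first exact: dvd2.
    by move=> p hp Ip; apply: NNPP => ng; apply: (nex e en); exists p.
  case: i i2 id it => [|[|[|i]]] i2 id it; [by []|by []|by rewrite t2|].
  rewrite szt in it; rewrite tS //.
  have B e : (e <= n)%N -> (e.+2 < j)%N -> hilbert I e.+2 = ('C(e.+1 + 3, 2)).+1.
    move=> en ej; exact: (hilbert_before gI h2 hw w0 dvd2 socI h1 hj hgt ej (dvd e en)).
  rewrite !B; [|lia|lia|lia|lia].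
  by rewrite addSn binS bin1; lia.
have [nex|[d [f [hf If nf]] nex]] := least j.
  (* Taking [m] beyond the length of the sequence makes the conditions on the tail vacuous. *)
  by apply: (@O_sequence_crit _ j.+2) => // [i|i|i]; [apply: low | lia | lia].
(* The first extra form has degree [d + 3], so [t_i = i + 1] up to [d + 2], exactly where the
   nonincreasing tail begins. *)
have [tpos tdec] := tail d.+2 isT (line_of_extra_form gI h2 hw w0 dvd2 hf If nf).
by apply: (@O_sequence_crit _ d.+2) => // i; apply: low.
Qed.
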